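(* Let $p$ be an odd prime and let $B$ be a Rota--Baxter operator on $H_3$. Then $B$ and $\widetilde B$ are both bijective if and only if, up to conjugation by automorphisms of $H_3$ and the action $\widetilde{\ }$, the operator $B$ is equal to one of the following operators, given by their parameter tuples $\chi=(l_\alpha,l_\beta,m_\alpha,m_\beta,x_\alpha,x_\beta,k)\in\mathbb{Z}_p^7$: \begin{itemize} \item $B^1_{k,m}$: $(0,-1,k(m+1),m,0,0,k)$, $1\le k<(p-1)/2$, $m\in\mathbb{Z}_p\setminus\{-1\}$; \item $B^3_m$: $(m,0,0,m,0,0,m^2/(2m+1))$, $1\le m<(p-1)/2$; \item $O^1_m$: $(0,-1,\frac{p-1}{2}(m+1),m,0,0,\frac{p-1}{2})$, $0\le m<(p-1)/2$. \end{itemize}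
   Context: Convention: $[g,h]=g^{-1}h^{-1}gh$. $H_3=\langle a,b,c\mid [a,b]=c,\ [a,c]=[b,c]=a^p=b^p=c^p=e\rangle$, of order $p^3$; every element is uniquely $b^sa^tc^r$ with $s,t,r\in\mathbb{Z}_p=\mathbb{Z}/p\mathbb{Z}$. A Rota--Baxter operator on a group $G$ is a map $B\colon G\to G$ such that $B(g)B(h)=B\big(gB(g)hB(g)^{-1}\big)$ for all $g,h\in G$. Every Rota--Baxter operator on $H_3$ has the form $$B(b^sa^tc^r)=b^{m_\alpha t+m_\beta s}\,a^{l_\alpha t+l_\beta s}\,c^{B_\gamma(t,s,r)},$$ $$B_\gamma(t,s,r)=x_\alpha t+x_\beta s+(l_\beta m_\alpha+km_\beta)ts+m_\alpha(l_\alpha+k)\tfrac{t(t-1)}{2}+l_\beta(m_\beta-k)\tfrac{s(s-1)}{2}+kr,$$ for a unique tuple $\chi(B)=(l_\alpha,l_\beta,m_\alpha,m_\beta,x_\alpha,x_\beta,k)\in\mathbb{Z}_p^7$, and a tuple defines a Rota--Baxter operator in this way if and only if $l_\alpha m_\beta-kl_\alpha=l_\beta m_\alpha+km_\beta+k$. If $B$ is a Rota--Baxter operator on $G$, then so are $\widetilde B$, where $\widetilde B(g)=g^{-1}B(g^{-1})$, and $\varphi^{-1}\circ B\circ\varphi$ for $\varphi\in\mathrm{Aut}(G)$. ''Up to conjugation and the action $\widetilde{\ }$'' refers to the equivalence relation generated by $B\sim\varphi^{-1}\circ B\circ\varphi$ ($\varphi\in\mathrm{Aut}(G)$) and $B\sim\widetilde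 B$. *)

(* Defs.v *)
From Stdlib Require Import Relation_Operators.
From mathcomp Require Import all_boot all_order all_algebra all_fingroup.

Set Implicit Arguments.
Unset Strict Implicit.
Unset Printing Implicit Defensive.

Import GRing.Theory.

Local Open Scope group_scope.

(* gT is the group H_3 presented on the marked generators a, b, c.  The
   presentation alone only fixes the isomorphism type, and operators are
   written in coordinates, so the generators are part of the data.
   MathComp's [~ x, y] is x^-1 * y^-1 * x * y.                                *)
Definition is_H3 (p : nat) (gT : finGroupType) (a b c : gT) : Prop :=
  [/\ [set: gT] \isog Grp (x : y : z :
        ([~ x, y] = z, [~ x, z], [~ y, z], x ^+ p, y ^+ p, z ^+ p)),
      <<[set a; b; c]>> = [set: gT]
    & [/\ [~ a, b] = c, [~ a, c] = 1, [~ b, c] = 1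
        & [/\ a ^+ p = 1, b ^+ p = 1 & c ^+ p = 1]]].

Section RotaBaxter.
Variable gT : finGroupType.
Implicit Types (B : {ffun gT -> gT}) (phi : {perm gT}).

Definition rota_baxter B : Prop :=
  forall g h : gT, B g * B h = B (g * B g * h * (B g)^-1).

Definition rb_tilde B : {ffun gT -> gT} := [ffun g => g^-1 * B g^-1].

Definition rb_conj phi B : {ffun gT -> gT} := [ffun g => phi^-1 (B (phi g))].

(* Both kinds of step, and their inverses, send Rota-Baxter operators to
   Rota-Baxter operators, so the closure below may be taken on all maps: the
   class of a Rota-Baxter operator consists of Rota-Baxter operators.         *)
Definition rb_step B1 B2 : Prop :=
  (exists2 phi, phi \in Aut [set: gT] & B2 = rb_conj phi B1)
  \/ B2 = rb_tilde B1.

Definition rb_equiv : {ffun gT -> gT} -> {ffun gT -> gT} -> Prop :=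
  clos_refl_sym_trans {ffun gT -> gT} rb_step.

End RotaBaxter.

(* (l_alpha, l_beta, m_alpha, m_beta, x_alpha, x_beta, k) *)
Definition rb_params (p : nat) : Type :=
  ('F_p * 'F_p * 'F_p * 'F_p * 'F_p * 'F_p * 'F_p)%type.

Definition B_gamma (p : nat) (chi : rb_params p) (t s r : 'F_p) : 'F_p :=
  let: (la, lb, ma, mb, xa, xb, k) := chi in
  (xa * t + xb * s + (lb * ma + k * mb) * (t * s)
   + ma * (la + k) * (t * (t - 1) / 2%:R)
   + lb * (mb - k) * (s * (s - 1) / 2%:R)
   + k * r)%R.

(* Exponents in 'F_p act through their representatives in {0, ..., p - 1}.
   Since every element of H_3 is some b^s a^t c^r, at most one B satisfies
   this for a given chi.                                                      *)
Definition has_chi (p : nat) (gT : finGroupType) (a b c : gT)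
    (B : {ffun gT -> gT}) (chi : rb_params p) : Prop :=
  let: (la, lb, ma, mb, xa, xb, k) := chi in
  forall s t r : 'F_p,
    B (b ^+ s * a ^+ t * c ^+ r)
    = b ^+ (ma * t + mb * s)%R * a ^+ (la * t + lb * s)%R
      * c ^+ (B_gamma chi t s r).

Local Open Scope ring_scope.

Definition chi_B1 (p : nat) (k m : 'F_p) : rb_params p :=
  (0, -1, k * (m + 1), m, 0, 0, k).

Definition chi_B3 (p : nat) (m : 'F_p) : rb_params p :=
  (m, 0, 0, m, 0, 0, m ^+ 2 / (2%:R * m + 1)).

Definition chi_O1 (p : nat) (m : 'F_p) : rb_params p :=
  let h : 'F_p := ((p - 1) %/ 2)%N%:R in
  (0, -1, h * (m + 1), m, 0, 0, h).

(* Parameters constrained by inequalities are natural numbers cast to 'F_p.   *)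
Definition bijective_list (p : nat) (chi : rb_params p) : Prop :=
  [\/ exists (k : nat) (m : 'F_p),
        [/\ (1 <= k < (p - 1) %/ 2)%N, m != -1 & chi = chi_B1 k%:R m],
      exists2 m : nat, (1 <= m < (p - 1) %/ 2)%N & chi = chi_B3 m%:R
    | exists2 m : nat, (m < (p - 1) %/ 2)%N & chi = chi_O1 m%:R].

(* Main.v *)
(* For a Rota-Baxter operator B, both B and g |-> g B(g) are homomorphisms from
   the circle group, g o h = g B(g) h B(g)^-1, to the Heisenberg group, and
   ~B is bijective iff the second one is.  When both are bijective, B acts on the
   centre by c |-> c^k with k <> 0, -1; since a, b, c also generate the circle
   group, B is determined by k, B a and B b in any basis (a, b, c = [a, b]).
   Comparing a o b with b o a shows that the matrix of B on the quotient by the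
   centre has determinant k (tr + 1).  If some x does not commute with B x, this
   matrix is not scalar, and a companion basis brings B to the form B^1 with
   m = tr; otherwise it is scalar and B is brought to the form B^3.  Passing to
   ~B replaces (k, tr) by (-1 - k, -2 - tr), resp. m by -1 - m, which brings
   the parameters into the stated ranges. *)
Require Import Defs.
From mathcomp Require Import all_boot all_order all_algebra all_fingroup.
From mathcomp Require Import all_solvable ring zify.
From Stdlib Require Import Relation_Operators.

Set Implicit Arguments.
Unset Strict Implicit.
Unset Printing Implicit Defensive.

Import GRing.Theory.

Local Open Scope group_scope.

(** * Coordinates, bases and automorphisms of the Heisenberg group over ['F_p] *)

Section Coordinates.
Variables (p : nat) (gT : finGroupType).
Hypotheses (p_prime : prime p) (p_odd : odd p).
Implicit Types (a b c x : gT).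

Lemma two_Fp_neq0 : (2%:R != 0 :> 'F_p)%R.
Proof.
by rewrite -unitfE unitFpE // coprime_sym prime_coprime // dvdn2 p_odd.
Qed.

(** Ring operations of ['F_p] reduce modulo [(Zp_trunc (pdiv p)).+2], which equals [p] only by
    rewriting; this removes the reduction from exponents. *)
Lemma expg_Fp_mod x (n : nat) :
  x ^+ p = 1 -> x ^+ (n %% (Zp_trunc (pdiv p)).+2) = x ^+ n.
Proof. by move=> xp; rewrite expg_mod // Fp_cast. Qed.

Lemma expg_FpD x (s t : 'F_p) : x ^+ p = 1 -> x ^+ (s + t)%R = x ^+ s * x ^+ t.
Proof. by move=> xp; rewrite -expgnDr -(expg_Fp_mod (s + t) xp). Qed.

Lemma expg_FpM x (s t : 'F_p) : x ^+ p = 1 -> x ^+ (s * t)%R = x ^+ (s * t)%N.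
Proof. by move=> xp; rewrite -(expg_Fp_mod (s * t) xp). Qed.

Lemma expg_Fp1 x : x ^+ (1%R : 'F_p) = x.
Proof. by rewrite /= modn_small. Qed.

Definition hcoord a b c (s t r : 'F_p) : gT := b ^+ s * a ^+ t * c ^+ r.

Definition heis_rel a b c : Prop :=
  [/\ [~ a, b] = c, [~ a, c] = 1, [~ b, c] = 1
    & [/\ a ^+ p = 1, b ^+ p = 1 & c ^+ p = 1]].

Definition hcoord3 a b c (u : 'F_p * 'F_p * 'F_p) : gT :=
  let: (s, t, r) := u in hcoord a b c s t r.

(** A form of the marked generators independent of the presentation, so that other noncommuting
    pairs can take over the role of [a] and [b]. *)
Definition heis_basis a b c : Prop :=
  heis_rel a b c /\ bijective (hcoord3 a b c).

Section Relations.
Variables a b c : gT.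
Hypothesis abc : heis_rel a b c.
Local Notation e := (hcoord a b c).

(** Collecting moves [a ^+ t] past [b ^+ s'], which costs the central factor [c ^+ (t * s')]. From
    here on group identities become polynomial identities over ['F_p]. *)
Lemma hcoordM s t r s' t' r' :
  e s t r * e s' t' r' = e (s + s')%R (t + t')%R (r + r' + t * s')%R.
Proof.
have [abE ac bc [ap bp cp]] := abc.
have cac : commute a c by apply/commgP/eqP.
have cbc : commute b c by apply/commgP/eqP.
have ca (n m : nat) : c ^+ n * a ^+ m = a ^+ m * c ^+ n.
  exact: commuteX2 (commute_sym cac).
have cb (n m : nat) : c ^+ n * b ^+ m = b ^+ m * c ^+ n.
  exact: commuteX2 (commute_sym cbc).
have ab : a ^+ t * b ^+ s' = b ^+ s' * a ^+ t * c ^+ (t * s')%N.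
  by rewrite commgC commXXg ?abE.
rewrite /hcoord !expg_FpD // expg_FpM // !mulgA.
rewrite -(mulgA _ (c ^+ r) (b ^+ s')) cb !mulgA.
rewrite -(mulgA _ (c ^+ r) (a ^+ t')) ca !mulgA.
rewrite -(mulgA _ (a ^+ t) (b ^+ s')) ab !mulgA.
rewrite -(mulgA _ (c ^+ (t * s')%N) (a ^+ t')) ca -!mulgA.
by do 4!congr (_ * _); rewrite -!expgnDr addnC addnA.
Qed.

Lemma hcoord_a : e 0%R 1%R 0%R = a.
Proof. by rewrite /hcoord expg_Fp1 mul1g mulg1. Qed.

Lemma hcoord_b : e 1%R 0%R 0%R = b.
Proof. by rewrite /hcoord expg_Fp1 !mulg1. Qed.

Lemma hcoord_c : e 0%R 0%R 1%R = c.
Proof. by rewrite /hcoord expg_Fp1 !mul1g. Qed.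

Lemma hcoord_1 : e 0%R 0%R 0%R = 1.
Proof. by rewrite /hcoord !mul1g. Qed.

Lemma hcoordV s t r : (e s t r)^-1 = e (- s)%R (- t)%R (- r + t * s)%R.
Proof.
apply/eqP; rewrite eq_invg_mul hcoordM -hcoord_1; apply/eqP.
by congr (hcoord _ _ _ _ _ _); ring.
Qed.

Lemma hcoordXn s t r (n : nat) :
  e s t r ^+ n = e (n%:R * s)%R (n%:R * t)%R
                   (n%:R * r + t * s * (n%:R * (n%:R - 1) / 2%:R))%R.
Proof.
have two0 := two_Fp_neq0.
elim: n => [|n IHn].
  rewrite expg0 -hcoord_1.
  by congr (hcoord _ _ _ _ _ _); rewrite !mul0r ?mulr0 ?addr0.
rewrite expgSr IHn hcoordM -!natr1.
by congr (hcoord _ _ _ _ _ _); field.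
Qed.

Lemma hcoordX s t r (n : 'F_p) :
  e s t r ^+ n = e (n * s)%R (n * t)%R
                   (n * r + t * s * (n * (n - 1) / 2%:R))%R.
Proof. by rewrite hcoordXn natr_Zp. Qed.

Lemma hcoord_exp s t r : e s t r ^+ p = 1.
Proof.
rewrite hcoordXn pchar_Fp_0 // -hcoord_1.
by congr (hcoord _ _ _ _ _ _); rewrite !mul0r ?mulr0 ?addr0.
Qed.

End Relations.

(** Since [c] has order exactly [p], commuting a trivial product with [a] forces [s = 0] and with
    [b] forces [t = 0]; only a power of [c] remains. *)
Lemma hcoord_inj_of_comm a b c : heis_rel a b c -> c != 1 ->
  injective (hcoord3 a b c).
Proof.
move=> abc c1; have [abE ac bc [ap bp cp]] := abc.
have cX0 (n : 'F_p) : c ^+ n = 1 -> n = 0%R.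
  have oc : #[c] = p by apply: nt_prime_order.
  move/eqP; rewrite -order_dvdn oc => pn; apply/eqP.
  by rewrite -[n]natr_Zp -(dvdn_pcharf (pchar_Fp p_prime)).
have e1 s t r : hcoord a b c s t r = 1 -> [/\ s = 0%R, t = 0%R & r = 0%R].
  move=> E.
  have s0 : s = 0%R.
    apply: cX0.
    have: a * hcoord a b c s t r = hcoord a b c s t r * a.
      by rewrite E mulg1 mul1g.
    rewrite -{1 4}(hcoord_a a b c) !hcoordM // !(add0r, addr0, mul1r, mulr0).
    rewrite (addrC 1%R) /hcoord => /mulgI.
    by rewrite expg_FpD // => /(canRL (mulKg _)); rewrite mulVg.
  have t0 : t = 0%R.
    apply: cX0.
    have: b * hcoord a b c s t r = hcoord a b c s t r * b.
      by rewrite E mulg1 mul1g.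
    rewrite -{1 4}(hcoord_b a b c) !hcoordM // !(add0r, addr0, mul0r, mulr1).
    rewrite (addrC 1%R) /hcoord => /mulgI.
    by rewrite expg_FpD // => /esym/(canRL (mulKg _)); rewrite mulVg.
  by split=> //; move: E; rewrite s0 t0 /hcoord !mul1g; apply: cX0.
move=> [[s t] r] [[s' t'] r'] /= E.
have: hcoord a b c s t r * (hcoord a b c s' t' r')^-1 = 1 by rewrite E mulgV.
rewrite hcoordV // hcoordM // => /e1[/subr0_eq -> /subr0_eq -> E3].
by congr (_, _); apply/subr0_eq; rewrite -E3; ring.
Qed.


Lemma card_coord : #|{: 'F_p * 'F_p * 'F_p}| = (p ^ 3)%N.
Proof. by rewrite !card_prod card_Fp // -mulnA. Qed.

Section Basis.
Variables a b c : gT.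
Hypothesis abc : heis_basis a b c.
Local Notation e := (hcoord a b c).

Lemma basis_rel : heis_rel a b c. Proof. by case: abc. Qed.

Lemma hcoordI s t r s' t' r' : e s t r = e s' t' r' ->
  [/\ s = s', t = t' & r = r'].
Proof.
have [_ /bij_inj inj_e] := abc.
by move=> E; have [-> -> ->] := inj_e (s, t, r) (s', t', r') E.
Qed.

Lemma hcoordP x : exists s t r, x = e s t r.
Proof.
have [_ [g _ gK]] := abc.
by case Dg: (g x) => [[s t] r]; exists s, t, r; rewrite -{1}(gK x) Dg.
Qed.

Lemma card_heis : #|gT| = (p ^ 3)%N.
Proof. by have [_ /bij_eq_card <-] := abc; rewrite card_coord. Qed.

Lemma hcoordR s t r s' t' r' :
  [~ e s t r, e s' t' r'] = e 0%R 0%R (t * s' - t' * s)%R.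
Proof.
have R := basis_rel.
rewrite commgEl /conjg !(hcoordV, hcoordM) //.
by congr (hcoord _ _ _ _ _ _); ring.
Qed.

(** The commutator formula and the exponent [p] give the relations for any pair; a nontrivial
    commutator gives injectivity, and counting does the rest. *)
Lemma basis_of_comm x y : [~ x, y] != 1 -> heis_basis x y [~ x, y].
Proof.
have R := basis_rel => z1.
have xyz : heis_rel x y [~ x, y].
  have [s [t [r Dx]]] := hcoordP x; have [s' [t' [r' Dy]]] := hcoordP y.
  rewrite /heis_rel Dx Dy hcoordR !hcoord_exp // !hcoordR !mul0r !mulr0 subrr.
  by rewrite hcoord_1.
split=> //; apply: inj_card_bij; first exact: hcoord_inj_of_comm.
by rewrite card_coord card_heis.
Qed.

Lemma c_neq1 : c != 1.
Proof.
apply/eqP; rewrite -(hcoord_c a b c) -(hcoord_1 a b c) => /hcoordI[_ _ /eqP].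
by rewrite oner_eq0.
Qed.

End Basis.

(** The product formula in coordinates is the same in every basis, so matching coordinates is
    multiplicative. *)
Lemma basis_Aut a b c a' b' c' : heis_basis a b c -> heis_basis a' b' c' ->
  exists2 phi : {perm gT}, phi \in Aut [set: gT]
    & forall s t r, phi (hcoord a b c s t r) = hcoord a' b' c' s t r.
Proof.
move=> abc abc'; have [R [g eK gK]] := abc; have [R' [g' eK' gK']] := abc'.
pose f x := hcoord3 a' b' c' (g x).
have f_inj : injective f by move=> x y /(can_inj eK')/(can_inj gK).
have fE s t r : perm f_inj (hcoord a b c s t r) = hcoord a' b' c' s t r.
  by rewrite permE /f -[hcoord a b c s t r]/(hcoord3 a b c (s, t, r)) eK.
exists (perm f_inj) => //; rewrite inE; apply/andP; split.
  by apply/subsetP=> x; rewrite inE.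
apply/morphicP=> x y _ _.
have [s [t [r ->]]] := hcoordP abc x; have [s' [t' [r' ->]]] := hcoordP abc y.
by rewrite hcoordM // !fE hcoordM.
Qed.

(** The relations make the coordinates surjective. They cannot collapse, because the extraspecial
    group [p^{1+2}] of order [p ^ 3] satisfies the presentation and is therefore a quotient of
    [gT]. *)
Lemma is_H3_basis a b c : is_H3 p a b c -> heis_basis a b c.
Proof.
move=> [isoG genG [abE ac bc [ap bp cp]]].
have R : heis_rel a b c by [].
split=> //.
have surj x : exists u, x = hcoord3 a b c u.
  have: x \in <<[set a; b; c]>> by rewrite genG inE.
  case/gen_prodgP=> n [F FS ->]; elim: n F FS => [|n IHn] F FS.
    by exists (0, 0, 0)%R; rewrite big_ord0 [RHS]hcoord_1.
  rewrite big_ord_recr /=.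
  have [i|[[s t] r] -> /=] := IHn (fun i => F (widen_ord (leqnSn n) i)).
    exact: FS.
  have: exists u, F ord_max = hcoord3 a b c u.
    have := FS ord_max; rewrite !inE => /orP[/orP[]|] /eqP->.
    - by exists (0, 1, 0)%R; rewrite [RHS]hcoord_a.
    - by exists (1, 0, 0)%R; rewrite [RHS]hcoord_b.
    by exists (0, 0, 1)%R; rewrite [RHS]hcoord_c.
  move=> [[[s' t'] r'] ->] /=; rewrite hcoordM //.
  by exists (s + s', t + t', r + r' + t * s')%R.
have leG : (p ^ 3 <= #|gT|)%N.
  rewrite -cardsT -(card_pX1p2 p_prime); apply: leq_homg.
  rewrite isoG; have /existsP[[x y]] := isoGrp_hom (Grp_pX1p2 p_prime).
  move=> /= /eqP[defG xp yp xz yz].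
  (* The model is presented on two generators; their commutator serves as the third. *)
  apply/existsP; exists (x, y, [~ x, y]) => /=.
  rewrite !xpair_eqE /= xp yp.
  have cxz : commute x [~ x, y] by apply/commute_sym/commgP/eqP.
  have cyz : commute y [~ x, y] by apply/commute_sym/commgP/eqP.
  rewrite -commXg // xp comm1g !eqxx !andbT.
  have -> /= : [~ x, [~ x, y]] == 1 by apply/commgP.
  have -> /= : [~ y, [~ x, y]] == 1 by apply/commgP.
  rewrite !andbT -defG; apply/eqP/joing_idPl.
  by rewrite cycle_subG groupR // -cycle_subG ?joing_subl ?joing_subr.
have surjb x : exists u, hcoord3 a b c u == x.
  by have [u ->] := surj x; exists u.
have gK : cancel (fun x => xchoose (surjb x)) (hcoord3 a b c).
  by move=> x; apply/eqP; apply: (xchooseP (surjb x)).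
apply: (bij_can_bij _ gK); apply: inj_card_bij; first exact: can_inj gK.
by rewrite card_coord.
Qed.

End Coordinates.

(** * Rota--Baxter operators and the two equivalence moves on a finite group *)

Section GeneralGroup.
Variable gT : finGroupType.
Implicit Types (B : {ffun gT -> gT}) (phi : {perm gT}).

Lemma rota_baxter1 B : rota_baxter B -> B 1 = 1.
Proof.
move=> rbB; apply: (mulgI (B 1)).
by rewrite rbB !(mul1g, mulg1) mulgV.
Qed.

Lemma rb_tildeK B : rb_tilde (rb_tilde B) = B.
Proof. by apply/ffunP=> g; rewrite !ffunE invgK mulKg. Qed.

Lemma rb_tilde_rota_baxter B : rota_baxter B -> rota_baxter (rb_tilde B).
Proof.
move=> rbB g h; rewrite !ffunE.
set u := g^-1; set v := h^-1.
(* Inversion carries the circle product of [rb_tilde B] to that of [B]. *)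
have -> : (g * (u * B u) * h * (u * B u)^-1)^-1 = u * B u * v * (B u)^-1.
  by rewrite mulgA mulgV mul1g !invMg !invgK -/u -/v !mulgA.
by rewrite -rbB !mulgA mulgKV.
Qed.

Lemma rb_tilde_rb_conj phi B : phi \in Aut [set: gT] ->
  rb_tilde (rb_conj phi B) = rb_conj phi (rb_tilde B).
Proof.
move=> Aphi; apply/ffunP=> g; rewrite !ffunE.
have phiM := morphicP (Aut_morphic Aphi).
have phiV x : phi x^-1 = (phi x)^-1.
  exact: (morphV (autm_morphism Aphi) (in_setT x)).
apply: (@perm_inj _ phi).
by rewrite phiM ?inE // !permKV phiV.
Qed.

(** On a finite group injectivity already means bijectivity. *)
Definition rb_bij B := injective B /\ injective (rb_tilde B).

Lemma rb_bijE B : rb_bij B <-> bijective B /\ bijective (rb_tilde B).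
Proof.
split=> [[/injF_bij ? /injF_bij ?] // | [/bij_inj ? /bij_inj ?]]; by split.
Qed.

(** Conjugation commutes with [rb_tilde], and [rb_tilde], being an involution, merely swaps the two
    conditions. *)
Lemma rb_equiv_bij B B' : rb_equiv B B' -> rb_bij B <-> rb_bij B'.
Proof.
elim=> {B B'} [B B' [[phi Aphi ->] | ->] | B | B B' _ IH | B B' B'' _ IH _ IH'].
- rewrite /rb_bij rb_tilde_rb_conj //.
  have conj_inj (C : {ffun gT -> gT}) :
      injective C <-> injective (rb_conj phi C).
    split=> injC x y; rewrite ?ffunE; first by move/perm_inj/injC/perm_inj.
    move=> Exy; apply: (@perm_inj _ phi^-1); apply: injC.
    by rewrite !ffunE !permKV Exy.
  have [iB1 iB2] := conj_inj B; have [iT1 iT2] := conj_inj (rb_tilde B).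
  by split=> -[? ?]; split; auto.
- by rewrite /rb_bij rb_tildeK; split=> -[].
- exact: iff_refl.
- exact: iff_sym.
exact: iff_trans IH IH'.
Qed.

Lemma rb_tilde_injE B : injective (rb_tilde B) <-> injective (fun x => x * B x).
Proof.
split=> injB x y.
  by move=> E; apply: invg_inj; apply: injB; rewrite !ffunE !invgK.
by rewrite !ffunE => /injB /invg_inj.
Qed.

End GeneralGroup.

(** * Action on the centre, and reconstruction of [B] from its values on generators *)

Section Heisenberg.
Variables (p : nat) (gT : finGroupType).
Hypotheses (p_prime : prime p) (p_odd : odd p).
Local Notation hc := (@hcoord p gT).
Implicit Types (a b c x : gT) (B : {ffun gT -> gT}) (phi : {perm gT}).

(* If B z = c, then the two circle products of x and z have the same image, since c
   is central; hence z * B z, and with it z, is central. *)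
Lemma rb_center a b c B : heis_basis p a b c -> rota_baxter B -> rb_bij B ->
  exists k : 'F_p, [/\ (k != 0)%R, (k != -1)%R
    & forall h r, B (h * hc a b c 0%R 0%R r)
                  = B h * hc a b c 0%R 0%R (k * r)%R].
Proof.
move=> abc rbB [injB /rb_tilde_injE injP].
have R := basis_rel abc; have two0 := two_Fp_neq0 p_prime p_odd.
set e := hc a b c.
have eC x r : x * e 0%R 0%R r = e 0%R 0%R r * x.
  have [s [t [r' ->]]] := hcoordP abc x.
  by rewrite !hcoordM //; congr (hc _ _ _ _ _ _); ring.
have [z _ Bz] : exists2 z, True & B z = e 0%R 0%R 1%R.
  have /injF_bij[g _ gK] := injB.
  by exists (g (e 0%R 0%R 1%R)) => //; rewrite gK.
have B1 := rota_baxter1 rbB.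
have circP g h : (fun x => x * B x) (g * B g * h * (B g)^-1)
               = (g * B g) * (h * B h).
  by rewrite /= -rbB !mulgA mulgKV.
have PzC x : (x * B x) * (z * B z) = (z * B z) * (x * B x).
  rewrite -!circP; congr (_ * B _); apply: injB; rewrite -!rbB Bz eC //.
have zC x : x * (z * B z) = z * B z * x.
  have /injF_bij[g _ gK] := injP.
  by have := PzC (g x); rewrite (gK x).
have [j Dz] : exists j, z = e 0%R 0%R j.
  have [s [t [r Dz]]] := hcoordP abc z.
  move: zC; rewrite Bz Dz => zC.
  have := zC (e 0%R 1%R 0%R); have := zC (e 1%R 0%R 0%R); rewrite !hcoordM //.
  case/(hcoordI abc)=> _ _ /eqP; rewrite -subr_eq0 => /eqP Et.
  case/(hcoordI abc)=> _ _ /eqP; rewrite -subr_eq0 => /eqP Es.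
  exists r; congr (hc _ _ _ _ _ _).
    by rewrite -[RHS]Es; ring.
  by rewrite -[RHS]oppr0 -Et; ring.
have j0 : (j != 0)%R.
  apply: contraNneq (c_neq1 abc) => j0; rewrite -(hcoord_c p a b c) -/e -Bz.
  by rewrite Dz j0 [e _ _ _]hcoord_1 B1.
(* As [B z] is central, the circle product of [z] with [h] is the ordinary product [z * h]. *)
have Bzn n h : B (z ^+ n * h) = B z ^+ n * B h.
  elim: n => [|n IHn]; first by rewrite !mul1g.
  rewrite !expgS -!mulgA -IHn rbB; congr (B _).
  by rewrite Bz -[z * _ * _]mulgA -eC [z * (_ * e _ _ _)]mulgA mulgK.
(* [B] sends [z], the [j]-th power of [c], to [c], hence the multiplier is [1 / j]. If it were [-1],
   then [z * B z] would be [1] and injectivity of [x * B x] would give [z = 1]. *)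
exists j^-1%R; split; first by rewrite invr_eq0.
  apply: contraNneq j0 => jV.
  have Pz1 : z = 1.
    apply: injP; rewrite Bz B1 Dz mulg1 hcoordM // -[RHS](hcoord_1 p a b c).
    have -> : (j = -1)%R by rewrite -[j]invrK jV invrN1.
    by congr (hc _ _ _ _ _ _); ring.
  by move: Dz; rewrite Pz1 -(hcoord_1 p a b c) => /(hcoordI abc)[_ _ <-].
move=> h r; rewrite eC [RHS]eC.
have zX : z ^+ (j^-1 * r)%R = e 0%R 0%R r.
  by rewrite Dz hcoordX //; congr (hc _ _ _ _ _ _); field; rewrite ?j0 ?two0.
rewrite -zX Bzn Bz [e _ _ _]/(hc _ _ _ _ _ _) hcoordX //.
by congr (hc _ _ _ _ _ _ * _); field; rewrite ?j0 ?two0.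
Qed.

(** The circle products of [a] with [b] and of [b] with [a] differ by a central factor, which gives
    the relation between the parameters. Circle multiplication by [a] or [b] raises one coordinate
    by 1, so the formula follows by induction from the centre. *)
Lemma has_chi_of_gens a b c B (la lb ma mb xa xb k : 'F_p) :
    heis_basis p a b c -> rota_baxter B ->
    (forall h r, B (h * hc a b c 0%R 0%R r)
                 = B h * hc a b c 0%R 0%R (k * r)%R) ->
    B a = hc a b c ma la xa -> B b = hc a b c mb lb xb ->
  (la * mb - k * la = lb * ma + k * mb + k)%R /\
  has_chi a b c B (la, lb, ma, mb, xa, xb, k).
Proof.
move=> abc rbB Bc Ba Bb.
have R := basis_rel abc; have two0 := two_Fp_neq0 p_prime p_odd.
have rel : (la * mb = lb * ma + k * mb + k + k * la)%R.
  have [x [y [z Bab]]] := hcoordP abc (B (hc a b c 1%R 1%R 0%R)).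
  have := rbB b a; have := rbB a b; rewrite Ba Bb.
  set u := a * _ * _ * _; set v := b * _ * _ * _.
  have -> : u = hc a b c 1%R 1%R 0%R * hc a b c 0%R 0%R (la + 1)%R.
    rewrite /u -{1}(hcoord_a p a b c) -{3}(hcoord_b p a b c).
    rewrite hcoordV // !hcoordM //.
    by congr (hc _ _ _ _ _ _); ring.
  have -> : v = hc a b c 1%R 1%R 0%R * hc a b c 0%R 0%R (- mb)%R.
    rewrite /v -{1}(hcoord_b p a b c) -{3}(hcoord_a p a b c).
    rewrite hcoordV // !hcoordM //.
    by congr (hc _ _ _ _ _ _); ring.
  rewrite !Bc Bab !hcoordM // => /(hcoordI abc)[_ _ E1] /(hcoordI abc)[_ _ E2].
  have -> : (la * mb = xa + xb + la * mb - (xb + xa + lb * ma) + lb * ma)%R.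
    by ring.
  by rewrite E1 E2; ring.
split; first by rewrite rel; ring.
pose F s t r := hc a b c (ma * t + mb * s)%R (la * t + lb * s)%R
   (B_gamma (la, lb, ma, mb, xa, xb, k) t s r).
have B1 := rota_baxter1 rbB.
have F00 r : B (hc a b c 0%R 0%R r) = F 0%R 0%R r.
  rewrite -[hcoord _ _ _ _ _ _]mul1g Bc B1 mul1g.
  by congr (hc _ _ _ _ _ _); rewrite /=; field.
have FSt s t : (forall r, B (hc a b c s t r) = F s t r) ->
    forall r, B (hc a b c s (t + 1)%R r) = F s (t + 1)%R r.
  (* The shift in the last coordinate cancels the commutators created by the circle product, so that
     the product has last coordinate exactly [r]. *)
  move=> IH r; have := rbB a (hc a b c s t (r - ((la + 1) * s - ma * t))%R).
  rewrite Ba IH => E; transitivity (B (a * hc a b c ma la xa *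
    hc a b c s t (r - ((la + 1) * s - ma * t))%R * (hc a b c ma la xa)^-1)).
    congr (B _); rewrite -{2}(hcoord_a p a b c) hcoordV // !hcoordM //.
    by congr (hc _ _ _ _ _ _); ring.
  rewrite -E hcoordM //.
  by congr (hc _ _ _ _ _ _); rewrite /=; field : rel.
have FSs s t : (forall r, B (hc a b c s t r) = F s t r) ->
    forall r, B (hc a b c (s + 1)%R t r) = F (s + 1)%R t r.
  move=> IH r; have := rbB b (hc a b c s t (r - (lb * s - mb * t))%R).
  rewrite Bb IH => E; transitivity (B (b * hc a b c mb lb xb *
    hc a b c s t (r - (lb * s - mb * t))%R * (hc a b c mb lb xb)^-1)).
    congr (B _); rewrite -{2}(hcoord_b p a b c) hcoordV // !hcoordM //.
    by congr (hc _ _ _ _ _ _); ring.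
  rewrite -E hcoordM //.
  by congr (hc _ _ _ _ _ _); rewrite /=; field : rel.
move=> s t; rewrite -[s]natr_Zp -[t]natr_Zp.
elim: (nat_of_ord s) => [|n IHn]; last by rewrite -natr1; apply: FSs.
elim: (nat_of_ord t) => [|n IHn]; last by rewrite -natr1; apply: FSt.
exact: F00.
Qed.

End Heisenberg.

(** * Parameter tuples: change of basis, bijectivity criterion and normal forms *)

Section Classification.
Variables (p : nat) (gT : finGroupType).
Hypotheses (p_prime : prime p) (p_odd : odd p).
Local Notation hc := (@hcoord p gT).
Implicit Types (a b c x : gT) (B : {ffun gT -> gT}) (phi : {perm gT}).
Implicit Types (k m la lb ma mb xa xb : 'F_p).

(** Conjugating by the automorphism that matches the two bases moves the tuple to the fixed basis;
    hence normal forms may be sought by choosing bases. *)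
Lemma has_chi_conj a b c a' b' c' B (chi : rb_params p) :
    heis_basis p a b c -> heis_basis p a' b' c' -> has_chi a' b' c' B chi ->
  exists2 phi, phi \in Aut [set: gT] & has_chi a b c (rb_conj phi B) chi.
Proof.
move=> abc abc' chiB; have [phi Aphi phiE] := basis_Aut p_prime abc abc'.
exists phi => //; move: chi chiB => [[[[[[la lb] ma] mb] xa] xb] k] chiB s t r.
rewrite ffunE; apply: (@perm_inj _ phi); rewrite permKV.
by rewrite [LHS](congr1 B (phiE s t r)) [RHS]phiE [LHS]chiB.
Qed.

(** Modulo the centre the matrix [M] of [B] becomes [- 1 - M]; the two constants in the central
    coordinate are read off at [a] and [b]. *)
Lemma has_chi_tilde a b c B la lb ma mb xa xb k :
    heis_basis p a b c -> (la * mb - k * la = lb * ma + k * mb + k)%R ->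
    has_chi a b c B (la, lb, ma, mb, xa, xb, k) ->
  has_chi a b c (rb_tilde B)
    (- la - 1, - lb, - ma, - mb - 1, - xa + ma * (la + k + 1),
     - xb + lb * (mb - k), - 1 - k)%R.
Proof.
move=> abc rel chiB s t r; have R := basis_rel abc.
have two0 := two_Fp_neq0 p_prime p_odd.
have {}rel : (la * mb = lb * ma + k * mb + k + k * la)%R by rewrite -rel; ring.
have hcV := hcoordV p_prime R.
rewrite ffunE [LHS](congr1 (fun y => y * B y) (hcV s t r)) chiB hcoordM //.
by congr (hc _ _ _ _ _ _); rewrite /=; field : rel.
Qed.

Lemma has_chi_inj a b c B la lb ma mb xa xb k :
    heis_basis p a b c -> has_chi a b c B (la, lb, ma, mb, xa, xb, k) ->
    (la * mb - lb * ma != 0)%R -> (k != 0)%R ->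
  injective B.
Proof.
move=> abc chiB det0 k0 x y.
have [s [t [r ->]]] := hcoordP abc x; have [s' [t' [r' ->]]] := hcoordP abc y.
rewrite !chiB => /(hcoordI abc)[Es Et Er].
(* Cramer's rule for the action on the quotient by the centre. *)
have tt' : t = t'.
  apply: (mulfI det0).
  have -> : ((la * mb - lb * ma) * t
             = mb * (la * t + lb * s) - lb * (ma * t + mb * s))%R by ring.
  by rewrite Es Et; ring.
have ss' : s = s'.
  apply: (mulfI det0).
  have -> : ((la * mb - lb * ma) * s
             = la * (ma * t + mb * s) - ma * (la * t + lb * s))%R by ring.
  by rewrite Es Et; ring.
by move: Er; rewrite tt' ss' /= => /addrI/(mulfI k0)->.
Qed.

(** The relation makes the determinant [k * (la + mb + 1)] for [B] and [(1 + k) * (la + mb + 1)] for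
    [rb_tilde B]. *)
Lemma has_chi_bij a b c B la lb ma mb xa xb k :
    heis_basis p a b c -> has_chi a b c B (la, lb, ma, mb, xa, xb, k) ->
    (la * mb - k * la = lb * ma + k * mb + k)%R ->
    (la + mb + 1 != 0)%R -> (k != 0)%R -> (k != -1)%R ->
  rb_bij B.
Proof.
move=> abc chiB rel tr0 k0 k1.
have rel' : (la * mb = lb * ma + k * mb + k + k * la)%R.
  by rewrite -[LHS](subrK (k * la)%R) rel.
have k1' : (- 1 - k != 0)%R by rewrite subr_eq0 eq_sym.
split.
  apply: (has_chi_inj abc chiB) => //.
  have -> : (la * mb - lb * ma = k * (la + mb + 1))%R by ring : rel'.
  by rewrite mulf_neq0.
apply: (has_chi_inj abc (has_chi_tilde abc rel chiB)) => //.
rewrite (_ : _ - _ = - (- 1 - k) * (la + mb + 1))%R; last by ring : rel'.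
by rewrite mulf_neq0 // oppr_eq0.
Qed.

Lemma natr_Fp_neq0 n : (0 < n < p)%N -> (n%:R != 0 :> 'F_p)%R.
Proof.
by case/andP=> n0 np; rewrite -(dvdn_pcharf (pchar_Fp p_prime)) gtnNdvd.
Qed.

Lemma half_odd : p = (2 * ((p - 1) %/ 2)).+1%N.
Proof. by move: p_odd; clear; lia. Qed.

(** So [(p - 1) %/ 2] represents [-1/2], the fixed point of [k |-> -1 - k] and the pole of
    [m ^+ 2 / (2%:R * m + 1)]. *)
Lemma half_Fp : (2%:R * ((p - 1) %/ 2)%N%:R + 1 = 0 :> 'F_p)%R.
Proof. by rewrite -natrM natr1 -half_odd pchar_Fp_0. Qed.

Lemma bijective_list_bij a b c B (chi : rb_params p) :
    heis_basis p a b c -> has_chi a b c B chi -> bijective_list chi ->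
  rb_bij B.
Proof.
move=> abc chiB; have two0 := two_Fp_neq0 p_prime p_odd.
have Dp := half_odd; have Dh := half_Fp.
have nat0 := natr_Fp_neq0.
have nat1 n : (n.+1 < p)%N -> (n%:R != -1 :> 'F_p)%R.
  by move=> np; rewrite -addr_eq0 natr1 nat0.
case=> [[k [m [/andP[k1 kh] m1 Dchi]]] | [m /andP[m1 mh] Dchi] | [m mh Dchi]].
- move: chiB; rewrite Dchi => /has_chi_bij; apply=> //; first by ring.
  + by rewrite add0r addr_eq0.
  + by apply: nat0; lia.
  by apply: nat1; lia.
- have m0 : (m%:R != 0 :> 'F_p)%R by apply: nat0; lia.
  have m2 : (2%:R * m%:R + 1 != 0 :> 'F_p)%R.
    by rewrite -natrM natr1 nat0 //; lia.
  move: chiB; rewrite Dchi => /has_chi_bij; apply=> //; first by field.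
  + by move: m2; rewrite mulr_natl mulr2n.
  + by rewrite mulf_neq0 ?expf_neq0 ?invr_eq0.
  (* For the scalar family [k + 1] is again a square over [2m + 1], nonzero because [m] is not
     [-1]. *)
  rewrite -addr_eq0 (_ : _ + 1 = (m.+1)%:R ^+ 2 / (2%:R * m%:R + 1))%R.
    by rewrite mulf_neq0 ?expf_neq0 ?invr_eq0 // nat0 //; lia.
  by rewrite -natr1; field.
move: chiB; rewrite Dchi => /has_chi_bij; apply=> //; first by ring.
- by rewrite add0r natr1 nat0 //; lia.
- by apply: nat0; have := prime_gt1 p_prime; lia.
by apply: nat1; have := prime_gt1 p_prime; lia.
Qed.

(** Quantifying over all bases lets [k] survive every later change of basis. *)
Definition central_mult B k : Prop :=
  forall a b c, heis_basis p a b c ->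
  forall h r, B (h * hc a b c 0%R 0%R r) = B h * hc a b c 0%R 0%R (k * r)%R.

Lemma rb_central_mult a b c B :
    heis_basis p a b c -> rota_baxter B -> rb_bij B ->
  exists k, [/\ k != 0, k != -1 & central_mult B k]%R.
Proof.
move=> abc rbB bijB; have R := basis_rel abc.
have [k [k0 k1 Bc]] := rb_center p_prime p_odd abc rbB bijB.
exists k; split=> // a' b' c' abc' h r; have R' := basis_rel abc'.
(* Any two bases have proportional central generators, the factor being the determinant of the
   change of basis, and a scalar ignores this factor. *)
have [w Dw] : exists w,
    forall r, hc a' b' c' 0%R 0%R r = hc a b c 0%R 0%R (r * w)%R.
  have [[abE' _ _ _] _] := abc'.
  have [s1 [t1 [r1 Da]]] := hcoordP abc a'.
  have [s2 [t2 [r2 Db]]] := hcoordP abc b'.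
  exists (t1 * s2 - t2 * s1)%R => r'.
  rewrite /hcoord !mul1g -[in LHS]abE' Da Db hcoordR // hcoordX //.
  by rewrite /hcoord !mulr0 !mul1g mul0r addr0.
by rewrite !Dw Bc; congr (_ * hc _ _ _ _ _ _); ring.
Qed.

Lemma rb_has_chi a b c B k :
    heis_basis p a b c -> rota_baxter B -> central_mult B k ->
  exists la lb ma mb xa xb,
    (la * mb - k * la = lb * ma + k * mb + k)%R /\
    has_chi a b c B (la, lb, ma, mb, xa, xb, k).
Proof.
move=> abc rbB Bc; have [ma [la [xa Ba]]] := hcoordP abc (B a).
have [mb [lb [xb Bb]]] := hcoordP abc (B b).
exists la, lb, ma, mb, xa, xb.
exact: has_chi_of_gens (Bc _ _ _ abc) Ba Bb.
Qed.

(* The new basis has b' = b c^v and B b' = b'^m a'^-1, where m is the trace of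
   the matrix of B; then B a' = b'^(k (m + 1)) up to a power of c, which
   vanishes for exactly one v because k (k + 1) != 0. *)
Lemma has_chi_B1 a b c B la lb ma mb xa xb k :
    heis_basis p a b c -> rota_baxter B -> central_mult B k ->
    (k != 0)%R -> (k != -1)%R -> (lb != 0)%R ->
    (la * mb - k * la = lb * ma + k * mb + k)%R ->
    has_chi a b c B (la, lb, ma, mb, xa, xb, k) ->
  exists a' b' c', heis_basis p a' b' c' /\
    has_chi a' b' c' B (chi_B1 k (la + mb)%R).
Proof.
move=> abc rbB Bc k0 k1 lb0 rel chiB; have R := basis_rel abc.
have two0 := two_Fp_neq0 p_prime p_odd.
have {}k1 : (1 + k != 0)%R by rewrite addrC addr_eq0.
have {}rel : (lb * ma = la * mb - k * la - k * mb - k)%R by rewrite rel; ring.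
have [v vE] : exists v, (k ^+ 2 * v = - (xa * lb) + xb * la
    - (lb * ma + k * mb) * (lb * la) + ma * (la + k) * (lb * (lb + 1) / 2%:R)
    + lb * (mb - k) * (la * (la - 1) / 2%:R) - k * (xb + lb * la) - k * v)%R.
  exists ((- (xa * lb) + xb * la
    - (lb * ma + k * mb) * (lb * la) + ma * (la + k) * (lb * (lb + 1) / 2%:R)
    + lb * (mb - k) * (la * (la - 1) / 2%:R) - k * (xb + lb * la))
    / (k * (1 + k)))%R.
  by field; rewrite k0 k1 two0.
pose m : 'F_p := (la + mb)%R.
(* This value is forced by the central coordinate of [B b' = b' ^+ m * a'^-1]. *)
pose w : 'F_p := (- (xb + k * v) + m * v - lb * la)%R.
pose b' := hc a b c 1%R 0%R v; pose a' := hc a b c la (- lb)%R w.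
have Dc' : [~ a', b'] = hc a b c 0%R 0%R (- lb)%R.
  by rewrite hcoordR //; congr (hc _ _ _ _ _ _); ring.
have c'1 : [~ a', b'] != 1.
  rewrite Dc' -(hcoord_1 p a b c); apply: contra_neq lb0.
  by case/(hcoordI abc)=> _ _ /eqP; rewrite oppr_eq0 => /eqP.
have abc' := basis_of_comm p_prime p_odd abc c'1.
exists a', b', [~ a', b']; split=> //.
have B_b' : B b' = hc a' b' [~ a', b'] m (- 1)%R 0%R.
  rewrite [LHS]chiB [RHS]/hcoord mulg1 !hcoordX // hcoordM //.
  by congr (hc _ _ _ _ _ _); rewrite /w /m /=; field.
have B_a' : B a' = hc a' b' [~ a', b'] (k * (m + 1))%R 0%R 0%R.
  rewrite [LHS]chiB [RHS]/hcoord !mulg1 hcoordX //.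
  congr (hc _ _ _ _ _ _); rewrite /=; first by rewrite /m; ring : rel.
    by ring.
  apply/subr0_eq; rewrite -[RHS](subrr (k ^+ 2 * v)%R) {1}vE /w /m.
  by field.
have [_ chiB'] :=
  has_chi_of_gens p_prime p_odd abc' rbB (Bc _ _ _ abc') B_a' B_b'.
exact: chiB'.
Qed.

(** Every vector of the quotient by the centre is an eigenvector, so the matrix is a scalar [m] and
    the relation reads [m ^+ 2 = k * (2%:R * m + 1)]. Multiplying [a] and [b] by central elements
    then removes [xa] and [xb], since [m != k]. *)
Lemma has_chi_B3 a b c B k :
    heis_basis p a b c -> rota_baxter B -> central_mult B k ->
    (k != 0)%R -> (k != -1)%R -> (forall x, [~ B x, x] = 1) ->
  exists m a' b' c', [/\ (2%:R * m + 1 != 0)%R, heis_basis p a' b' c',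
     (k = m ^+ 2 / (2%:R * m + 1))%R & has_chi a' b' c' B (chi_B3 m)].
Proof.
move=> abc rbB Bc k0 k1 comB; have R := basis_rel abc.
have two0 := two_Fp_neq0 p_prime p_odd.
have [la [lb [ma [mb [xa [xb [rel chiB]]]]]]] := rb_has_chi abc rbB Bc.
have com s t : ((la * t + lb * s) * s - t * (ma * t + mb * s) = 0)%R.
  have := comB (hc a b c s t 0%R); rewrite chiB hcoordR // -(hcoord_1 p a b c).
  by case/(hcoordI abc)=> _ _ <-; ring.
have lb0 : lb = 0%R by rewrite -(com 1%R 0%R); ring.
have ma0 : ma = 0%R by rewrite -[RHS]oppr0 -(com 0%R 1%R); ring.
have la_mb : la = mb.
  by apply/subr0_eq; rewrite -(com 1%R 1%R) lb0 ma0; ring.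
move: la_mb lb0 ma0 rel chiB {com} => -> -> -> {la lb ma}.
move: mb => m rel chiB.
have {}rel : (m ^+ 2 = k * (2%:R * m + 1))%R.
  have -> : (m ^+ 2 = m * m - k * m + k * m)%R by ring.
  by rewrite rel; ring.
have m2 : (2%:R * m + 1 != 0)%R.
  apply/eqP=> m2; move/eqP: rel; rewrite m2 mulr0 expf_eq0 /= => /eqP m0.
  by move/eqP: m2; rewrite m0 mulr0 add0r oner_eq0.
have Dk : (k = m ^+ 2 / (2%:R * m + 1))%R by rewrite rel mulfK.
have mk : (m - k != 0)%R.
  apply: contra_neq k1 => /subr0_eq mk; apply: (mulfI k0).
  move: rel; rewrite mk => rel.
  have -> : (k * k = k * (2%:R * k + 1) - k * k - k)%R by ring.
  by rewrite -rel; ring.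
(* Replacing [a] by [a * c ^+ u] adds [k * u] to the central coordinate of its image, while the
   [m]-th power gains [m * u]. *)
have solve y : exists u, (y = m * u - k * u)%R.
  by exists (y / (m - k))%R; rewrite -mulrBl mulrC divfK.
have [[u uE] [v vE]] := (solve xa, solve xb).
pose a' := hc a b c 0%R 1%R u; pose b' := hc a b c 1%R 0%R v.
have Dc' : [~ a', b'] = c.
  by rewrite hcoordR // -[RHS](hcoord_c p a b c); congr (hc _ _ _ _ _ _); ring.
have c'1 : [~ a', b'] != 1 by rewrite Dc' (c_neq1 abc).
have abc' := basis_of_comm p_prime p_odd abc c'1.
exists m, a', b', [~ a', b']; split=> //.
have B_a' : B a' = hc a' b' [~ a', b'] 0%R m 0%R.
  rewrite [LHS]chiB [RHS]/hcoord mulg1 mul1g hcoordX //.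
  by congr (hc _ _ _ _ _ _); rewrite /= ?uE; field.
have B_b' : B b' = hc a' b' [~ a', b'] m 0%R 0%R.
  rewrite [LHS]chiB [RHS]/hcoord !mulg1 hcoordX //.
  by congr (hc _ _ _ _ _ _); rewrite /= ?vE; field.
have [_ chiB'] :=
  has_chi_of_gens p_prime p_odd abc' rbB (Bc _ _ _ abc') B_a' B_b'.
by rewrite /chi_B3 -Dk; apply: chiB'.
Qed.

End Classification.

(** * Moving the parameters into the stated ranges by means of [rb_tilde] *)

Section Range.
Variables (p : nat) (gT : finGroupType) (a b c : gT).
Hypotheses (p_prime : prime p) (p_odd : odd p) (abc : heis_basis p a b c).
Local Notation hc := (@hcoord p gT).
Local Notation half := ((p - 1) %/ 2)%N.
Implicit Types (B : {ffun gT -> gT}) (k m : 'F_p).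

Definition listed B : Prop := exists (B' : {ffun gT -> gT}) (chi : rb_params p),
  [/\ rb_equiv B B', has_chi a b c B' chi & bijective_list chi].

Lemma listed_basis a' b' c' B (chi : rb_params p) :
    heis_basis p a' b' c' -> has_chi a' b' c' B chi -> bijective_list chi ->
  listed B.
Proof.
move=> abc' chiB chi_list.
have [phi Aphi chiB'] := has_chi_conj p_prime abc abc' chiB.
by exists (rb_conj phi B), chi; split=> //; apply: rst_step; left; exists phi.
Qed.

Lemma listed_tilde B : listed (rb_tilde B) -> listed B.
Proof.
case=> B' [chi [eqB chiB' chi_list]]; exists B', chi; split=> //.
by apply: rst_trans eqB; apply: rst_step; right.
Qed.

Lemma Fp_ltn k : (k < p)%N.
Proof. by rewrite -[X in (_ < X)%N](Fp_cast p_prime). Qed.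

Lemma Fp_ltn_pred k : (k != -1)%R -> (k < p - 1)%N.
Proof.
move=> k1; have := Fp_ltn k.
rewrite leq_eqVlt => /orP[/eqP kp | kp]; last by lia.
by move: k1; rewrite -[k]natr_Zp -addr_eq0 natr1 kp pchar_Fp_0 ?eqxx.
Qed.

Lemma Fp_gt0 k : (k != 0)%R -> (0 < k)%N.
Proof. by rewrite lt0n -val_eqE. Qed.

Lemma natr_Fp_sub (n : nat) k :
  (k + n <= p)%N -> ((p - n - k)%N%:R = - n%:R - k)%R.
Proof.
by move=> knp; rewrite !natrB ?pchar_Fp_0 ?natr_Zp ?sub0r //; lia.
Qed.

Lemma listed_of_trace_form a' b' c' B k m :
    heis_basis p a' b' c' -> has_chi a' b' c' B (chi_B1 k m) ->
    (k != 0)%R -> (m != -1)%R -> (k < half \/ k = half :> nat /\ m < half)%N ->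
  listed B.
Proof.
move=> abc' chiB k0 m1 range; apply: (listed_basis abc' chiB).
have kE := natr_Zp k; have mE := natr_Zp m.
case: range => [kh | [kh mh]].
  by apply: Or31; exists k, m; rewrite kE Fp_gt0.
by apply: Or33; exists m => //; rewrite /chi_O1 mE -kh kE.
Qed.

(** A central factor [c ^+ r] contributes [- r] through [g^-1] and [- k * r] through [B g^-1]. *)
Lemma central_mult_tilde B k :
  central_mult B k -> central_mult (rb_tilde B) (- 1 - k)%R.
Proof.
move=> Bc a' b' c' abc' h r; have R := basis_rel abc'.
have hcC x t : x * hc a' b' c' 0%R 0%R t = hc a' b' c' 0%R 0%R t * x.
  have [s1 [t1 [r1 ->]]] := hcoordP abc' x.
  by rewrite !hcoordM //; congr (hc _ _ _ _ _ _); ring.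
rewrite !ffunE hcC invMg hcoordV // oppr0 mul0r addr0 Bc // mulgA.
rewrite -(mulgA h^-1) -hcC (mulgA h^-1) -(mulgA _ _ (hc _ _ _ _ _ (k * _)%R)).
congr (_ * _).
by rewrite hcoordM //; congr (hc _ _ _ _ _ _); ring.
Qed.

Lemma listed_noncomm B : rota_baxter B -> rb_bij B ->
  (exists x, [~ B x, x] != 1) -> listed B.
Proof.
move=> rbB bijB [x cx].
have [k [k0 k1 Bc]] := rb_central_mult p_prime p_odd abc rbB bijB.
have xbasis := basis_of_comm p_prime p_odd abc cx.
have [la [lb [ma [mb [xa [xb [rel chiB]]]]]]] :=
  rb_has_chi p_prime p_odd xbasis rbB Bc.
(* In the basis starting with [B x] and [x], the operator sends the second generator to the first,
   so [lb = 1]. *)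
have lb0 : lb != 0%R.
  have Bx : B (hc (B x) x [~ B x, x] 1%R 0%R 0%R)
            = hc (B x) x [~ B x, x] 0%R 1%R 0%R by rewrite hcoord_b hcoord_a.
  have [_ lb1 _] := hcoordI xbasis (etrans (esym (chiB 1%R 0%R 0%R)) Bx).
  have -> : lb = 1%R by rewrite -lb1; ring.
  exact: oner_neq0.
have [a1 [b1 [c1 [abc1 chi1]]]] :=
  has_chi_B1 p_prime p_odd xbasis rbB Bc k0 k1 lb0 rel chiB.
move: (la + mb)%R chi1 => m chi1.
clear - p_prime p_odd abc rbB bijB k0 k1 Bc abc1 chi1.
have R1 := basis_rel abc1.
(* For [m = -1] the entry [k * (m + 1)] vanishes, hence [B a1 = 1] and injectivity would make [a1]
   trivial. *)
have m1 : (m != -1)%R.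
  apply: contra_neq (c_neq1 abc1) => m1.
  have Ba : B (hc a1 b1 c1 0%R 1%R 0%R) = 1.
    rewrite [LHS]chi1 -[RHS](hcoord_1 p a1 b1 c1) m1.
    by congr (hc _ _ _ _ _ _); rewrite /=; ring.
  have a1E : a1 = 1.
    by apply: bijB.1; rewrite -{1}(hcoord_a p a1 b1 c1) Ba rota_baxter1.
  by have [<- _ _ _] := R1; rewrite a1E comm1g.
have rel1 : (0 * m - k * 0 = -1 * (k * (m + 1)) + k * m + k)%R by ring.
have chi1' := has_chi_tilde p_prime p_odd abc1 rel1 chi1.
have [range | [kh range]] : (k < half \/ k = half :> nat /\ m < half)%N \/
    (half <= k /\ (k = half :> nat -> half <= m))%N by lia.
  exact: listed_of_trace_form abc1 chi1 k0 m1 range.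
apply: listed_tilde; have rbT := rb_tilde_rota_baxter rbB.
have BcT := central_mult_tilde Bc.
have rel1' : ((- 0 - 1) * (- m - 1) - (- 1 - k) * (- 0 - 1)
  = - -1 * - (k * (m + 1)) + (- 1 - k) * (- m - 1) + (- 1 - k))%R by ring.
have k0' : (- 1 - k != 0)%R by rewrite subr_eq0 eq_sym.
have k1' : (- 1 - k != -1)%R.
  by rewrite -subr_eq0 (_ : _ - _ = - k)%R ?oppr_eq0 //; ring.
(* The tuple of [rb_tilde B] has [lb = 1] instead of [-1], so it must be normalized once more, in a
   new basis. *)
have l0' : (- -1 != 0 :> 'F_p)%R by rewrite opprK oner_neq0.
have [a2 [b2 [c2 [abc2 chi2]]]] :=
  has_chi_B1 p_prime p_odd abc1 rbT BcT k0' k1' l0' rel1' chi1'.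
apply: (listed_of_trace_form abc2 chi2) => //.
  by rewrite -subr_eq0 (_ : _ - _ = - (m + 1))%R ?oppr_eq0 ?addr_eq0 //; ring.
have kp := Fp_ltn_pred k1; have mp := Fp_ltn_pred m1.
have Dp := half_odd p_odd.
(* The representatives become [p - 1 - k] and [p - 2 - m]. As [p - 1] is twice [half], the first is
   at most [half], with equality only for [k = half], where the second drops below [half]. *)
have kE : (- 1 - k)%R = (p - 1 - k)%N :> nat.
  rewrite -[(- 1 - k)%R](@natr_Fp_sub 1) ?val_Fp_nat ?modn_small //; lia.
have mE : (- 0 - 1 + (- m - 1))%R = (p - 2 - m)%N :> nat.
  rewrite (_ : _ + _ = - 2%:R - m)%R; last by ring.
  rewrite -natr_Fp_sub ?val_Fp_nat ?modn_small //; lia.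
rewrite kE mE; have [] := eqVneq (nat_of_ord k) half; lia.
Qed.

Lemma listed_comm B : rota_baxter B -> rb_bij B ->
  (forall x, [~ B x, x] = 1) -> listed B.
Proof.
move=> rbB bijB comB.
have [k [k0 k1 Bc]] := rb_central_mult p_prime p_odd abc rbB bijB.
have [m [a1 [b1 [c1 [m2 abc1 kE chi1]]]]] :=
  has_chi_B3 p_prime p_odd abc rbB Bc k0 k1 comB.
have Dp := half_odd p_odd; have Dh := half_Fp p_prime p_odd.
have mE := natr_Zp m.
have m0 : m != 0%R.
  by apply: contraNneq k0 => m0; rewrite kE m0 expr0n mul0r.
have m1 : m != (-1)%R.
  apply: contraNneq k1 => m1; rewrite kE m1 sqrrN expr1n.
  have -> : (2%:R * -1 + 1 = -1 :> 'F_p)%R by ring.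
  by rewrite invrN1 mul1r.
have mh : m <> half :> nat.
  by move=> mh; move: m2; rewrite -mE mh Dh eqxx.
have mp := Fp_ltn_pred m1.
have [mlt | mgt] := ltnP m half.
  apply: (listed_basis abc1 chi1); apply: Or32; exists m; last by rewrite mE.
  by rewrite Fp_gt0.
apply: listed_tilde.
have rel1 : (m * m - m ^+ 2 / (2%:R * m + 1) * m = 0 * 0 +
   m ^+ 2 / (2%:R * m + 1) * m + m ^+ 2 / (2%:R * m + 1))%R by field.
(* The scalar form is preserved in the same basis with [m] replaced by [-1 - m], whose
   representative [p - 1 - m] lies strictly between [0] and [half]. *)
have chi1' := has_chi_tilde p_prime p_odd abc1 rel1 chi1.
apply: (listed_basis abc1 chi1'); apply: Or32; exists (p - 1 - m)%N; first lia.
have m2' : (2%:R * (- 1 - m) + 1 != 0)%R.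
  by rewrite (_ : _ + _ = - (2%:R * m + 1))%R ?oppr_eq0 //; ring.
rewrite natr_Fp_sub; last lia.
rewrite /chi_B3; congr (_, _, _, _, _, _, _); try ring.
by field; rewrite m2'.
Qed.

End Range.

Theorem proposition11 (p : nat) (p_prime : prime p) (p_odd : odd p)
    (gT : finGroupType) (a b c : gT) (H3 : is_H3 p a b c)
    (B : {ffun gT -> gT}) (rbB : rota_baxter B) :
  (bijective B /\ bijective (rb_tilde B)) <->
  (exists (B' : {ffun gT -> gT}) (chi : rb_params p),
     [/\ rb_equiv B B', has_chi a b c B' chi & bijective_list chi]).
Proof.
have abc := is_H3_basis p_prime H3.
split=> [/rb_bijE bijB | [B' [chi [eqB chiB' chi_list]]]]; last first.
  apply/rb_bijE/(rb_equiv_bij eqB).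
  exact: bijective_list_bij abc chiB' chi_list.
have [/forallP comB | ] := boolP [forall x, [~ B x, x] == 1].
  by apply: (listed_comm p_prime p_odd abc rbB bijB) => x; apply/eqP.
rewrite negb_forall => /existsP; exact: listed_noncomm.
Qed.
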